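(* Let $n\ge 3$ and let $DW_n=2C_n+K_1$ be the double wheel graph. Then $$cn_{\chi}(DW_n)=\begin{cases} n, & n \text{ even},\\ n-1, & n\text{ odd},\end{cases} \qquad\text{and}\qquad cn^c_{\chi}(DW_n)=\begin{cases} n^2, & n \text{ even},\\ 2(n-1)^2, & n\text{ odd}.\end{cases}$$
   Context: All graphs are finite, simple, undirected and connected. A chromatic colouring of a graph $G$ is a proper vertex colouring with exactly $\chi(G)$ colours $c_1,\ldots,c_\ell$, $\ell=\chi(G)$; the colour class of $c_i$ is denoted $\mathcal{C}_i$ and $\theta(c_i)=|\mathcal{C}_i|$. A $\chi^-$-colouring of $G$ is a chromatic colouring in which the maximum possible number of vertices gets colour $c_1$, then (subject to that) the maximum possible number of the remaining vertices gets $c_2$, then the maximum possible number of the remaining vertices gets $c_3$, and so on; that is, $(\theta(c_1),\ldots,\theta(c_\ell))$ is lexicographically maximal among all chromatic colourings of $G$. With respect to a $\chi^-$-colouring, the chromatic curling number is $cn_{\chi}(G)=\max\{\theta(c_i):1\le i\le \ell\}$ and the chromatic compound curling number is $cn^c_{\chi}(G)=\prod_{i=1}^{\ell}\theta(c_i)$. The double wheel graph $DW_n=2C_n+K_1$ is obtained by joining all vertices of two disjoint cycles, each of order $n$, to one external vertex. *)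

(* Defs.v *)
From mathcomp Require Import all_boot all_order.

Set Implicit Arguments.
Unset Strict Implicit.
Unset Printing Implicit Defensive.

Import Order.TTheory.

Record sgraph := SGraph {
  vertex :> finType;
  adj : rel vertex;
  adj_sym : symmetric adj;
  adj_irrefl : irreflexive adj }.

Definition connected (G : sgraph) := forall x y : G, connect (@adj G) x y.

Section Constructions.

(* C_n is only meant for 3 <= n; the clause i != j removes the loop at n = 1. *)
Definition cycle_adj n : rel 'I_n :=
  fun i j => (i != j) && ((j == ordS i) || (i == ordS j)).

Lemma cycle_adj_sym n : symmetric (@cycle_adj n).
Proof. by move=> i j; rewrite /cycle_adj eq_sym orbC. Qed.

Lemma cycle_adj_irrefl n : irreflexive (@cycle_adj n).
Proof. by move=> i; rewrite /cycle_adj eqxx. Qed.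

Definition cycle_graph n := SGraph (@cycle_adj_sym n) (@cycle_adj_irrefl n).

Definition complete_adj n : rel 'I_n := fun i j => i != j.

Lemma complete_adj_sym n : symmetric (@complete_adj n).
Proof. by move=> i j; rewrite /complete_adj eq_sym. Qed.

Lemma complete_adj_irrefl n : irreflexive (@complete_adj n).
Proof. by move=> i; rewrite /complete_adj eqxx. Qed.

Definition complete_graph n :=
  SGraph (@complete_adj_sym n) (@complete_adj_irrefl n).

(* [cross] says whether vertices of different summands are adjacent: [false]
   gives the disjoint union of G and H, [true] gives their join G + H. *)
Definition sum_adj (cross : bool) (G H : sgraph) : rel (G + H)%type :=
  fun u v => match u, v with
             | inl x, inl y => adj x y
             | inr x, inr y => adj x y
             | _, _ => cross
             end.

Lemma sum_adj_sym cross G H : symmetric (@sum_adj cross G H).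
Proof. by move=> [x|x] [y|y] //=; exact: adj_sym. Qed.

Lemma sum_adj_irrefl cross G H : irreflexive (@sum_adj cross G H).
Proof. by move=> [x|x] /=; exact: adj_irrefl. Qed.

Definition disjoint_union (G H : sgraph) :=
  SGraph (@sum_adj_sym false G H) (@sum_adj_irrefl false G H).

Definition join (G H : sgraph) :=
  SGraph (@sum_adj_sym true G H) (@sum_adj_irrefl true G H).

Definition double_wheel n :=
  join (disjoint_union (cycle_graph n) (cycle_graph n)) (complete_graph 1).

Lemma double_wheel_connected n : connected (double_wheel n).
Proof.
have hub (z : double_wheel n) :
    connect (@adj (double_wheel n)) z (inr ord0 : double_wheel n).
  by case: z => [z|z]; [exact: connect1 | rewrite (ord1 z) connect0].
have csym := sym_connect_sym (@adj_sym (double_wheel n)).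
by move=> x y; apply: connect_trans (hub x) _; rewrite csym.
Qed.

End Constructions.

Section Colouring.
Variable G : sgraph.

Definition proper k (f : {ffun G -> 'I_k}) :=
  [forall x, forall y, adj x y ==> (f x != f y)].

Definition colourable : pred nat :=
  fun k => [exists f : {ffun G -> 'I_k}, proper f].

Lemma exists_colourable : exists k, colourable k.
Proof.
exists #|G|; apply/existsP; exists [ffun x => enum_rank x].
apply/forallP=> x; apply/forallP=> y; apply/implyP=> xy.
rewrite !ffunE (inj_eq enum_rank_inj).
by apply: contraTneq xy => ->; rewrite adj_irrefl.
Qed.

Definition chi : nat := ex_minn exists_colourable.

(* Colours are numbered from 0: the colour i : 'I_chi stands for c_(i+1). *)
Definition chromatic (f : {ffun G -> 'I_chi}) :=
  proper f && [forall i, exists x, f x == i].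

Definition theta k (f : {ffun G -> 'I_k}) (i : 'I_k) : nat :=
  #|[set x | f x == i]|.

Definition theta_vec k (f : {ffun G -> 'I_k}) : k.-tuplelexi nat :=
  [tuple theta f i | i < k].

Definition chi_minus (f : {ffun G -> 'I_chi}) :=
  chromatic f &&
  [forall g, chromatic g ==> (theta_vec g <= theta_vec f)%O].

Lemma exists_chromatic : exists f, chromatic f.
Proof.
rewrite /chromatic /chi; case: ex_minnP => k /existsP[f pf] kmin.
exists f; rewrite pf /=; apply/forallP=> i; apply/existsP.
case: (pickP (fun x => f x == i)) => [x fx|fNi]; first by exists x.
have neq x : i != f x by rewrite eq_sym fNi.
have: colourable k.-1.
  apply/existsP; exists [ffun x => s2val (unlift_some (neq x))].
  apply/forallP=> x; apply/forallP=> y; apply/implyP=> xy; rewrite !ffunE.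
  have /forallP/(_ x)/forallP/(_ y)/implyP/(_ xy) := pf.
  apply: contra_neq => eq_xy.
  have fE z : f z = lift i (s2val (unlift_some (neq z))).
    by case: (unlift_some (neq z)).
  by rewrite !fE eq_xy.
by move/kmin; rewrite -ltnS prednK ?ltnn // (leq_ltn_trans _ (ltn_ord i)).
Qed.

Lemma exists_chi_minus : exists f, chi_minus f.
Proof.
have [f0 chf0] := exists_chromatic.
case: (@Order.TotalTheory.arg_maxP _ _ _ f0 chromatic (@theta_vec _) chf0).
move=> f chf fmax; exists f; rewrite /chi_minus chf /=.
by apply/forallP=> g; apply/implyP; exact: fmax.
Qed.

(* The curling numbers refer to a chi^- colouring; lemmas [cn_chiE] and
   [cnc_chiE] show that its choice is immaterial. *)
Definition chi_minus_colouring := xchoose exists_chi_minus.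

Definition cn_chi : nat := \max_(i < chi) theta chi_minus_colouring i.

Definition cnc_chi : nat := \prod_(i < chi) theta chi_minus_colouring i.

Lemma chi_minus_theta f g : chi_minus f -> chi_minus g -> theta f =1 theta g.
Proof.
move=> /andP[chf /forallP maxf] /andP[chg /forallP maxg] i.
have /implyP/(_ chf) fg := maxg f; have /implyP/(_ chg) gf := maxf g.
have /(congr1 (fun t : chi.-tuple nat => tnth t i)) :
    theta_vec f = theta_vec g by apply: le_anti; rewrite fg gf.
by rewrite !tnth_mktuple.
Qed.

Lemma chi_minus_colouringP : chi_minus chi_minus_colouring.
Proof. exact: xchooseP. Qed.

Lemma cn_chiE f : chi_minus f -> cn_chi = \max_(i < chi) theta f i.
Proof.
move=> mf; apply: eq_bigr => i _.
exact: chi_minus_theta chi_minus_colouringP mf i.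
Qed.

Lemma cnc_chiE f : chi_minus f -> cnc_chi = \prod_(i < chi) theta f i.
Proof.
move=> mf; apply: eq_bigr => i _.
exact: chi_minus_theta chi_minus_colouringP mf i.
Qed.

End Colouring.

(* Main.v *)
Require Import Defs.
From mathcomp Require Import all_boot all_order.
From mathcomp Require Import zify.

(** A colour class of the double wheel is either the hub alone or meets each
    rim in an independent set, hence has at most [2 * n./2] elements.  Adding up
    the classes, [2n + 1 <= 1 + (k - 1) * (2 * n./2)] for a proper [k]-colouring,
    so that [k] is at least 3, and at least 4 when [n] is odd.  An explicit
    colouring reaches this bound on [k] with classes [n, n, 1] or
    [n - 1, n - 1, 2, 1]; as the first two classes are as large as possible,
    every lexicographically maximal colouring has the same class sizes. *)

Set Implicit Arguments.
Unset Strict Implicit.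
Unset Printing Implicit Defensive.

(** The successor map is injective and sends an independent set [S] to a set disjoint from it, so
    two copies of [S] fit into the [n] vertices. *)
Lemma cycle_indep_card n (S : {set cycle_graph n}) : 1 < n ->
  (forall x y, x \in S -> y \in S -> ~~ adj x y) -> #|S| <= n./2.
Proof.
move=> n_gt1 indS.
have ordSneq (i : 'I_n) : i != ordS i.
  apply/eqP => /(congr1 val) /=.
  have [lt_in|] := ltnP i.+1 n; first by rewrite modn_small //; lia.
  by move=> ge_in; have -> : i.+1 = n by [have := ltn_ord i; lia]; rewrite modnn; lia.
have disj : [disjoint S & [set ordS i | i in S]].
  rewrite disjoints_subset; apply/subsetP => x xS; rewrite inE.
  apply/imsetP => -[y yS xE]; have := indS y x yS xS.
  by rewrite /adj /= /cycle_adj xE eqxx orTb andbT ordSneq.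
have := max_card (S :|: [set ordS i | i in S]).
rewrite /= card_ord cardsU disjoint_setI0 // cards0 subn0.
by rewrite card_imset ?geq_half_double ?addnn; last exact: ordS_inj.
Qed.

Section Colouring.
Variables (G : sgraph) (k : nat).
Implicit Types f g : {ffun G -> 'I_k}.

Lemma properP f :
  reflect (forall x y, adj x y -> f x != f y) (Defs.proper f).
Proof.
apply: (iffP forallP) => [pf x y|pf x].
  by move: (pf x) => /forallP/(_ y)/implyP.
by apply/forallP => y; apply/implyP; exact: pf.
Qed.

Lemma sum_theta f : \sum_(i < k) theta f i = #|G|.
Proof.
rewrite -sum1_card (partition_big f predT) //=.
by apply: eq_bigr => i _; rewrite /theta -sum1_card; apply: eq_bigl => x; rewrite inE.
Qed.

(** Lets class sizes be compared one colour at a time: if the vectors first differed at some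
    [m < i], then [theta g m < theta f m], against the hypothesis at [m]. *)
Lemma theta_vec_lexi f g (i : 'I_k) : (theta_vec g <= theta_vec f)%O ->
  (forall j : 'I_k, j < i -> theta f j <= theta g j) -> theta g i <= theta f i.
Proof.
case/lexi_tupleP => m le_gf; have [le_im _|lt_mi le_fg] := leqP i m.
  by have [] := le_gf i le_im; rewrite !tnth_mktuple leEnat.
have lt_mk : m < k := ltn_trans lt_mi (ltn_ord i).
have [] := le_gf (Ordinal lt_mk) (leqnn m); rewrite !tnth_mktuple leEnat /= eqxx.
move=> le_m; rewrite eqn_leq le_m (le_fg (Ordinal lt_mk)) //.
Qed.

End Colouring.

Lemma chi_eq (G : sgraph) k : colourable G k ->
  (forall l, colourable G l -> k <= l) -> chi G = k.
Proof.
move=> colk kmin; rewrite /chi; case: ex_minnP => l coll lmin.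
by apply/eqP; rewrite eqn_leq lmin ?kmin.
Qed.

(* Replacing [chi G] by its value [k] makes the colours ['I_k] enumerable. *)
Lemma chi_minus_cast (G : sgraph) k : chi G = k ->
  exists f : {ffun G -> 'I_k},
    [/\ Defs.proper f, (forall i, 0 < theta f i),
        (forall g : {ffun G -> 'I_k}, Defs.proper g -> (forall i, 0 < theta g i) ->
           (theta_vec g <= theta_vec f)%O),
        cn_chi G = \max_(i < k) theta f i
      & cnc_chi G = \prod_(i < k) theta f i].
Proof.
move=> <-{k}; exists (chi_minus_colouring G).
have /andP[/andP[pf /forallP sf] /forallP maxf] := chi_minus_colouringP G.
split=> // [i|g pg sg].
  by apply/card_gt0P; have /existsP[x fx] := sf i; exists x; rewrite inE.
apply: (implyP (maxf g)); rewrite /chromatic pg; apply/forallP => i.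
by have /card_gt0P[x] := sg i; rewrite inE => gx; apply/existsP; exists x.
Qed.

Section DoubleWheel.
Variable n : nat.
Hypothesis n_ge3 : 3 <= n.

Let hub : double_wheel n := inr ord0.
Let rim (b : bool) (i : cycle_graph n) : double_wheel n :=
  inl (if b then inl i else inr i).

Lemma card_double_wheel : #|double_wheel n| = n + n + 1.
Proof. by rewrite !card_sum !card_ord. Qed.

Lemma theta_double_wheel k (f : {ffun double_wheel n -> 'I_k}) c :
  theta f c = #|[set i | f (rim true i) == c]|
            + #|[set i | f (rim false i) == c]| + (f hub == c).
Proof.
rewrite /theta -!sum1dep_card big_sumType /= big_sumType /=; congr (_ + _).
by rewrite big_mkcond big_ord1; case: (f _ == c).
Qed.

Section Proper.
Variables (k : nat) (f : {ffun double_wheel n -> 'I_k}).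
Hypothesis pf : Defs.proper f.

Lemma theta_hub : theta f (f hub) = 1.
Proof.
rewrite theta_double_wheel eqxx; have rim0 b : [set i | f (rim b i) == f hub] = set0.
  apply/setP => i; rewrite !inE; apply/negbTE.
  by apply: (properP f pf); case: b.
by rewrite !rim0 cards0.
Qed.

Lemma theta_le c : theta f c <= 2 * n./2.
Proof.
have [->|Nhub] := eqVneq c (f hub); first by rewrite theta_hub; lia.
rewrite theta_double_wheel eq_sym (negbTE Nhub).
have le_rim b : #|[set i | f (rim b i) == c]| <= n./2.
  apply: cycle_indep_card => [|x y]; first lia.
  rewrite !inE => /eqP fx /eqP fy; apply/negP => xy.
  have := properP f pf (rim b x) (rim b y).
  by rewrite fx fy eqxx; case: b {fx fy} => /(_ xy).
by have := le_rim true; have := le_rim false; lia.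
Qed.

Lemma double_wheel_colours : 3 + odd n <= k.
Proof.
have := sum_theta f; rewrite card_double_wheel (bigD1 (f hub)) //= theta_hub.
have le_sum : \sum_(i < k | i != f hub) theta f i <= k.-1 * (2 * n./2).
  apply: (@leq_trans (\sum_(i < k | i != f hub) 2 * n./2)).
    by apply: leq_sum => i _; exact: theta_le.
  rewrite sum_nat_const leq_mul2r; apply/orP; right.
  have := cardC1 (f hub); rewrite card_ord => <-.
  by apply: subset_leq_card; apply/subsetP => i.
rewrite leqNgt => total; apply/negP => lt_k.
have := leq_add (leqnn 1) le_sum; rewrite {}total.
(* With too few colours, the classes other than the hub's cover at most [n] rim vertices for even
   [n] and [2 * (n - 1)] for odd [n], short of [2 * n]. *)
have : k.-1 * (2 * n./2) <= (1 + odd n) * (2 * n./2).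
  by rewrite leq_mul2r; apply/orP; right; lia.
by case: (odd n) (odd_double_half n) => /=; lia.
Qed.

End Proper.

(** Colours 0 and 1 alternate; for odd [n] the last vertex would get 0, like its neighbour 0, so it
    takes 2. *)
Definition rim_colour (i : nat) : nat :=
  if odd n && (i == n.-1) then 2 else odd i.

Lemma rim_colour_succ i : i < n -> rim_colour (i.+1 %% n) != rim_colour i.
Proof.
move=> lt_in; rewrite /rim_colour; have [lt|ge] := ltnP i.+1 n.
  by rewrite modn_small //; do 2 case: ifP; lia.
by have -> : i.+1 = n; [lia | rewrite modnn; do 2 case: ifP; lia].
Qed.

(** The hub takes the last colour, which puts the class sizes in non-increasing order. *)
Definition dw_colour (x : double_wheel n) : nat :=
  match x with
  | inl (inl i) | inl (inr i) => rim_colour (i : 'I_n)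
  | inr _ => 2 + odd n
  end.

Definition dw_colouring : {ffun double_wheel n -> 'I_(3 + odd n)} :=
  [ffun x => inord (dw_colour x)].

(** All colours are below [3 + odd n], so [inord] never returns its default. *)
Lemma dw_colouringE x : dw_colouring x = dw_colour x :> nat.
Proof.
rewrite ffunE inordK //; case: x => [[i|i]|i] //=; rewrite /rim_colour;
  case: ifP; lia.
Qed.

Lemma dw_colouring_proper : Defs.proper dw_colouring.
Proof.
have rimN (i j : 'I_n) : cycle_adj i j -> rim_colour i != rim_colour j.
  case/andP => _ /orP[] /eqP-> /=; last exact: rim_colour_succ.
  by rewrite eq_sym rim_colour_succ.
apply/properP => x y xy; rewrite -val_eqE /= !dw_colouringE.
case: x y xy => [[i|i]|i] [[j|j]|j] //=; try exact: rimN.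
1-4: by move=> _; rewrite /rim_colour; case: ifP; lia.
by rewrite /adj /= /complete_adj (ord1 i) (ord1 j).
Qed.

Lemma chi_double_wheel : chi (double_wheel n) = 3 + odd n.
Proof.
apply: chi_eq => [|l /existsP[f]]; last exact: double_wheel_colours.
by apply/existsP; exists dw_colouring; exact: dw_colouring_proper.
Qed.

Lemma theta_dw_colouring_hub (c : 'I_(3 + odd n)) :
  c = 2 + odd n :> nat -> theta dw_colouring c = 1.
Proof.
move=> cE; have -> : c = dw_colouring hub by apply: val_inj; rewrite /= dw_colouringE.
exact: theta_hub dw_colouring_proper.
Qed.

(** Each rim contributes only its last vertex. *)
Lemma theta_dw_colouring_odd (c : 'I_(3 + odd n)) :
  odd n -> c = 2 :> nat -> theta dw_colouring c = 2.
Proof.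
move=> n_odd cE; rewrite theta_double_wheel.
have -> : (dw_colouring hub == c) = false.
  by rewrite -val_eqE /= dw_colouringE cE /= n_odd.
have lt_n : n.-1 < n by lia.
have rim1 b : [set i | dw_colouring (rim b i) == c] = [set Ordinal lt_n].
  apply/setP => i; rewrite !inE -val_eqE /= dw_colouringE cE -val_eqE /=.
  by case: b; rewrite /= /rim_colour n_odd /=; case: ifP; lia.
by rewrite !rim1 cards1.
Qed.

End DoubleWheel.

Theorem theorem3 (n : nat) (n_ge3 : 3 <= n) :
  cn_chi (double_wheel n) = (if odd n then n - 1 else n) /\
  cnc_chi (double_wheel n) = (if odd n then 2 * (n - 1) ^ 2 else n ^ 2).
Proof.
have [f [pf sf maxf -> ->]] := chi_minus_cast (chi_double_wheel n_ge3).
have pg := dw_colouring_proper n_ge3; set g := dw_colouring n in pg.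
(* Indexing the class sizes by naturals frees them from the type ['I_(3 + odd n)], so that [odd n]
   can be split later. *)
pose F i := theta f (inord i : 'I_(2 + odd n).+1).
pose G i := theta g (inord i : 'I_(2 + odd n).+1).
have fE i : theta f i = F i by rewrite /F inord_val.
have gE i : theta g i = G i by rewrite /G inord_val.
have G_hub : G (2 + odd n) = 1 by apply: theta_dw_colouring_hub; rewrite ?inordK.
have G_odd : odd n -> G 2 = 2.
  by move=> n_odd; apply: theta_dw_colouring_odd; rewrite ?inordK ?n_odd.
have G_le i : G i <= 2 * n./2 by exact: theta_le.
have F_le i : F i <= 2 * n./2 by exact: theta_le.
have F_gt0 i : 0 < F i by exact: sf.
(* Maximality of [f] concerns colourings that use every colour; for [g] this is checked in each
   case, once the values of [G] are known. *)
have lex : (forall i, i < 3 + odd n -> 0 < G i) ->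
    forall i, i < 3 + odd n -> (forall j, j < i -> F j <= G j) -> G i <= F i.
  move=> G_gt0 i lt_i le_FG; apply: theta_vec_lexi.
    by apply: maxf => // j; rewrite gE G_gt0.
  by move=> j; rewrite inordK // fE gE; exact: le_FG.
have := sum_theta g; have := sum_theta f; rewrite card_double_wheel.
clearbody F G; do 3 rewrite (eq_bigr _ (fun i _ => fE i)).
rewrite (eq_bigr _ (fun i _ => gE i)) => sumF sumG.
have nE := odd_double_half n.
move: lex G_hub G_odd sumF sumG nE {f g pf pg fE gE sf maxf}.
case: (odd n) => /= lex G_hub G_odd; rewrite !big_ord_recr !big_ord0 /= => sumF sumG nE.
- have {G_odd} G2 := G_odd isT; have {G_hub} G3 : G 3 = 1 := G_hub.
  (* The total [2n + 1] leaves [2 * (n - 1)] for these two classes, and each is at most [n - 1]. *)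
  have [G0 G1] : G 0 = n.-1 /\ G 1 = n.-1.
    by have := G_le 0; have := G_le 1; lia.
  have {}lex : forall i, i < 4 -> (forall j, j < i -> F j <= G j) -> G i <= F i.
    by apply: lex => -[|[|[|[|]]]] //; lia.
  have F0 : F 0 = n.-1.
    have := F_le 0; have : G 0 <= F 0 by exact: lex.
    lia.
  have F1 : F 1 = n.-1.
    have := F_le 1; have : G 1 <= F 1 by apply: lex => // -[|j] //; lia.
    lia.
  (* Colours 2 and 3 share three vertices, and colour 3 needs at least one. *)
  have F2 : F 2 = 2.
    have := F_gt0 3; have : G 2 <= F 2 by apply: lex => // -[|[|j]] //; lia.
    lia.
  have F3 : F 3 = 1 by lia.
  by rewrite F0 F1 F2 F3; nia.
- have {G_hub} G2 : G 2 = 1 := G_hub.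
  have [G0 G1] : G 0 = n /\ G 1 = n.
    by have := G_le 0; have := G_le 1; lia.
  have {}lex : forall i, i < 3 -> (forall j, j < i -> F j <= G j) -> G i <= F i.
    by apply: lex => -[|[|[|]]] //; lia.
  have F0 : F 0 = n.
    have := F_le 0; have : G 0 <= F 0 by exact: lex.
    lia.
  have F1 : F 1 = n.
    have := F_le 1; have : G 1 <= F 1 by apply: lex => // -[|j] //; lia.
    lia.
  (* The first two classes leave a single vertex. *)
  have F2 : F 2 = 1 by lia.
  by rewrite F0 F1 F2; nia.
Qed.
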